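(* Let $A$ be an $\ell$-controllable complete group system with generator group $(\mathcal{U},\circ)$, and let $(\mathbf{k}_u,\mathbf{t}_u)$ be any paired sequence. The set $\blacktriangledown_{\mathbf{k}_u}^{\mathbf{t}_u}(\mathcal{U})$ with the operation $\oplus_{\mathbf{k}_u}^{\mathbf{t}_u}$ given by $$\blacktriangledown_{\mathbf{k}_u}^{\mathbf{t}_u}(\dot{\mathbf{u}})\oplus_{\mathbf{k}_u}^{\mathbf{t}_u}\blacktriangledown_{\mathbf{k}_u}^{\mathbf{t}_u}(\ddot{\mathbf{u}})=\blacktriangledown_{\mathbf{k}_u}^{\mathbf{t}_u}(\dot{\mathbf{u}}\circ\ddot{\mathbf{u}})$$ forms a group $(\blacktriangledown_{\mathbf{k}_u}^{\mathbf{t}_u}(\mathcal{U}),\oplus_{\mathbf{k}_u}^{\mathbf{t}_u})$.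
   Context: Let $(A^t)_{t\in\mathbf{Z}}$ be finite groups. A group system $A$ is a set of sequences $\mathbf{a}=(a^t)_{t\in\mathbf{Z}}$, $a^t\in A^t$, forming a group under componentwise operation, such that every element of $A^t$ occurs as a time-$t$ component, for each $t$. $\chi^t:A\to A^t$ is $\mathbf{a}\mapsto a^t$. $A$ is $\ell$-controllable ($\ell>0$) if for every $t\in\mathbf{Z}$ and all $\dot{\mathbf{a}},\ddot{\mathbf{a}}\in A$ there is $\mathbf{a}\in A$ agreeing with $\dot{\mathbf{a}}$ at all times $<t$ and with $\ddot{\mathbf{a}}$ at all times $\ge t+\ell$. $A$ is complete if every sequence in $\prod_t A^t$ whose restriction to each finite interval is the restriction of some element of $A$ belongs to $A$. $A^{[m,n]}$ is the set of sequences in $A$ that are the identity outside $[m,n]$. $X^t$ (resp. $Y^t$) is the normal subgroup of sequences in $A$ that are the identity at all times $<t$ (resp. $>t$). Basis: for $t\in\mathbf{Z}$, $0\le k\le\ell$ put $\Lambda^{[t,t+k]}=X^{t+1}(X^t\cap Y^{t+k})/X^{t+1}(X^t\cap Y^{t+k-1})$. A basis is a choice, for each $(k,t)$, of a transversal $[\Lambda^{[t,t+k]}]$ whose elements (generators $\mathbf{g}^{[t,t+k]}$) lie in $A^{[t,t+k]}$ and in which the trivial coset is represented by the identity sequence. $\mathcal{R}=\prod_{t\in\mathbf{Z}}\prod_{0\le k\le\ell}[\Lambda^{[t,t+k]}]$. The map $\alpha:\mathcal{R}\to A$ sends $\mathbf{r}=(\mathbf{g}^{[t,t+k]})_{k,t}$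 to $\prod_{i=+\infty}^{-\infty}\prod_{m=0}^{\ell}\mathbf{g}^{[i,i+m]}$, i.e. the sequence with time-$t$ component $\prod_{j=0}^{\ell}\bigl(\prod_{k=j}^{\ell}\chi^t(\mathbf{g}^{[t-j,t-j+k]})\bigr)$ (factors written left to right in increasing $j$, and increasing $k$ for each $j$); $\alpha$ is a bijection. The operation $*$ on $\mathcal{R}$ is $\dot{\mathbf{r}}*\ddot{\mathbf{r}}=\alpha^{-1}(\alpha(\dot{\mathbf{r}})\alpha(\ddot{\mathbf{r}}))$. For each $(k,t)$ let $G_k^t$ be a set of labels with a fixed bijection $[\Lambda^{[t,t+k]}]\to G_k^t$, $\mathbf{g}^{[t,t+k]}\mapsto g_k^t$. $\mathcal{U}=\prod_{t\in\mathbf{Z}}\prod_{0\le k\le\ell}G_k^t$, and $\beta:\mathcal{R}\to\mathcal{U}$ replaces each generator by its label. The operation $\circ$ on $\mathcal{U}$ is $\beta(\dot{\mathbf{r}})\circ\beta(\ddot{\mathbf{r}})=\beta(\dot{\mathbf{r}}*\ddot{\mathbf{r}})$; $(\mathcal{U},\circ)$ is the generator group. Upper triangles: $T_k^t=\{(m,t-j):0\le j\le\ell-k,\ k+j\le m\le\ell\}$; for $\mathbf{u}=(g_m^s)\in\mathcal{U}$, $\nabla_{0,k}^t(\mathbf{u})=(g_m^s)_{(m,s)\in T_k^t}$. A paired sequence $(\mathbf{k}_u,\mathbf{t}_u)=\ldots,(k,t),(k',t'),\ldots$ is a finite or infinite sequence of pairs with $0\le k\le\ell$, times strictly decreasing along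 the sequence, and such that none of the triangles $T_k^t$ indexed by the sequence is contained in another one. $\blacktriangledown_{\mathbf{k}_u}^{\mathbf{t}_u}(\mathbf{u})$ is the sequence of triangles $\ldots,\nabla_{0,k}^t(\mathbf{u}),\nabla_{0,k'}^{t'}(\mathbf{u}),\ldots$ indexed by $(\mathbf{k}_u,\mathbf{t}_u)$, and $\blacktriangledown_{\mathbf{k}_u}^{\mathbf{t}_u}(\mathcal{U})=\{\blacktriangledown_{\mathbf{k}_u}^{\mathbf{t}_u}(\mathbf{u}):\mathbf{u}\in\mathcal{U}\}$. *)

(* Defs.v *)
From HB Require Import structures.
From mathcomp Require Import all_boot all_order all_algebra all_fingroup.
From mathcomp Require Import boolp classical_sets.
Set Implicit Arguments.
Unset Strict Implicit.
Unset Printing Implicit Defensive.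

Import Order.TTheory GRing.Theory Num.Theory.
Local Open Scope classical_set_scope.
Local Open Scope ring_scope.

Definition seqs (At : int -> finGroupType) : Type := forall t : int, At t.

HB.instance Definition _ (At : int -> finGroupType) :=
  Choice.copy (seqs At) (forall t : int, At t).

Definition seqs_one (At : int -> finGroupType) : seqs At :=
  fun t => 1%g.
Definition seqs_mul (At : int -> finGroupType) (a b : seqs At) : seqs At :=
  fun t => (a t * b t)%g.
Definition seqs_inv (At : int -> finGroupType) (a : seqs At) : seqs At :=
  fun t => ((a t)^-1)%g.

Lemma seqs_mulA (At : int -> finGroupType) : associative (@seqs_mul At).
Proof. by move=> a b c; apply: functional_extensionality_dep => t; exact: mulgA. Qed.
Lemma seqs_1mul (At : int -> finGroupType) :
  left_id (seqs_one At) (@seqs_mul At).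
Proof. by move=> a; apply: functional_extensionality_dep => t; exact: mul1g. Qed.
Lemma seqs_mul1 (At : int -> finGroupType) :
  right_id (seqs_one At) (@seqs_mul At).
Proof. by move=> a; apply: functional_extensionality_dep => t; exact: mulg1. Qed.
Lemma seqs_Vmul (At : int -> finGroupType) :
  left_inverse (seqs_one At) (@seqs_inv At) (@seqs_mul At).
Proof. by move=> a; apply: functional_extensionality_dep => t; exact: mulVg. Qed.
Lemma seqs_mulV (At : int -> finGroupType) :
  right_inverse (seqs_one At) (@seqs_inv At) (@seqs_mul At).
Proof. by move=> a; apply: functional_extensionality_dep => t; exact: mulgV. Qed.

HB.instance Definition _ (At : int -> finGroupType) :=
  isGroup.Build (seqs At) (@seqs_mulA At) (@seqs_1mul At) (@seqs_mul1 At)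
    (@seqs_Vmul At) (@seqs_mulV At).

Record group_system (At : int -> finGroupType) := GroupSystem {
  gs_set : set (seqs At);
  gs_one : gs_set 1%g;
  gs_mul : forall a b, gs_set a -> gs_set b -> gs_set (a * b)%g;
  gs_inv : forall a, gs_set a -> gs_set (a^-1)%g;
  gs_onto : forall (t : int) (x : At t), exists2 a, gs_set a & a t = x }.

Definition controllable (At : int -> finGroupType) (l : nat)
    (A : group_system At) : Prop :=
  (0 < l)%N /\
  forall (t : int) (a1 a2 : seqs At), gs_set A a1 -> gs_set A a2 ->
    exists2 a, gs_set A a & (forall s, s < t -> a s = a1 s) /\
                            (forall s, t + l%:Z <= s -> a s = a2 s).

Definition complete (At : int -> finGroupType) (A : group_system At) : Prop :=
  forall a : seqs At,
    (forall m n : int, exists2 b, gs_set A b &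
                          forall t, m <= t <= n -> b t = a t) ->
    gs_set A a.

Definition supported (At : int -> finGroupType) (A : group_system At)
    (m n : int) : set (seqs At) :=
  [set a | gs_set A a /\ forall s, ~~ (m <= s <= n) -> a s = 1%g].

Definition Xsub (At : int -> finGroupType) (A : group_system At) (t : int) :
    set (seqs At) :=
  [set a | gs_set A a /\ forall s, s < t -> a s = 1%g].

Definition Ysub (At : int -> finGroupType) (A : group_system At) (t : int) :
    set (seqs At) :=
  [set a | gs_set A a /\ forall s, t < s -> a s = 1%g].

Definition prod_set (gT : groupType) (P Q : set gT) : set gT :=
  [set (x * y)%g | x in P & y in Q].

(* The set of cosets of [M] in [N]; below, both are normal subgroups of [A]. *)
Definition cosets (gT : groupType) (N M : set gT) : set (set gT) :=
  [set prod_set [set x] M | x in N].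

(* X^{t+1} (X^t /\ Y^n); with n = t + k, resp. n = t + k - 1, it is the numerator,
   resp. denominator, of the granule. *)
Definition chain (At : int -> finGroupType) (A : group_system At) (t n : int) :
    set (seqs At) :=
  prod_set (Xsub A (t + 1)) (Xsub A t `&` Ysub A n).

(* For k = 0 the denominator is X^{t+1}, since X^t /\ Y^{t-1} is trivial. *)
Definition granule (At : int -> finGroupType) (A : group_system At) (k : nat)
    (t : int) : set (set (seqs At)) :=
  cosets (chain A t (t + k%:Z)) (chain A t (t + k%:Z - 1)).

Definition coset_transversal (T : Type) (C : set (set T)) (S : set T) : Prop :=
  (forall g, S g -> exists2 c, C c & c g) /\
  (forall c, C c -> exists! g, S g /\ c g).

(* Given the other fields, [gens_one] says that the trivial coset is represented
   by the identity sequence. *)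
Record basis (At : int -> finGroupType) (l : nat) (A : group_system At) :=
  Basis {
    gens :> 'I_l.+1 -> int -> set (seqs At);
    gens_transversal : forall (k : 'I_l.+1) t,
      coset_transversal (granule A k t) (gens k t);
    gens_supported : forall (k : 'I_l.+1) t,
      gens k t `<=` supported A t (t + k%:Z);
    gens_one : forall k t, gens k t 1%g }.

Definition Rtensors (At : int -> finGroupType) (l : nat) (A : group_system At)
    (B : basis l A) : Type :=
  forall (k : 'I_l.+1) (t : int), B k t.

HB.instance Definition _ (At : int -> finGroupType) (l : nat)
    (A : group_system At) (B : basis l A) :=
  Choice.copy (Rtensors B) (forall (k : 'I_l.+1) (t : int), B k t).

Definition Rone (At : int -> finGroupType) (l : nat) (A : group_system At)
    (B : basis l A) : Rtensors B :=
  fun k t => exist _ 1%g (mem_set (gens_one B k t)).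

(* The time-t component of the product of the generators r_{m,i}, taken with i
   decreasing and, for each i, m increasing; only the factors with i = t - j and
   0 <= j <= m <= l can be nontrivial at time t. *)
Definition alpha (At : int -> finGroupType) (l : nat) (A : group_system At)
    (B : basis l A) (r : Rtensors B) : seqs At :=
  fun t => (\prod_(j < l.+1) \prod_(k < l.+1 | (j <= k)%N)
              (val (r k (t - (j : nat)%:Z)%R)) t)%g.

(* [alpha] is a bijection onto [A] when [A] is complete and [l]-controllable;
   the default value [Rone] only serves to make the inverse total. *)
Definition alpha_inv (At : int -> finGroupType) (l : nat)
    (A : group_system At) (B : basis l A) (a : seqs At) : Rtensors B :=
  xget (Rone B) [set r | alpha r = a].

Definition Rmul (At : int -> finGroupType) (l : nat) (A : group_system At)
    (B : basis l A) (r1 r2 : Rtensors B) : Rtensors B :=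
  alpha_inv B (alpha r1 * alpha r2)%g.

Record labelling (At : int -> finGroupType) (l : nat) (A : group_system At)
    (B : basis l A) := Labelling {
  label :> 'I_l.+1 -> int -> Type;
  lab : forall k t, B k t -> label k t;
  unlab : forall k t, label k t -> B k t;
  labK : forall k t, cancel (@lab k t) (@unlab k t);
  unlabK : forall k t, cancel (@unlab k t) (@lab k t) }.

Definition Utensors (At : int -> finGroupType) (l : nat) (A : group_system At)
    (B : basis l A) (G : labelling B) : Type :=
  forall (k : 'I_l.+1) (t : int), G k t.

Definition beta (At : int -> finGroupType) (l : nat) (A : group_system At)
    (B : basis l A) (G : labelling B) (r : Rtensors B) : Utensors G :=
  fun k t => lab G (r k t).

Definition beta_inv (At : int -> finGroupType) (l : nat) (A : group_system At)
    (B : basis l A) (G : labelling B) (u : Utensors G) : Rtensors B :=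
  fun k t => unlab (u k t).

Definition Umul (At : int -> finGroupType) (l : nat) (A : group_system At)
    (B : basis l A) (G : labelling B) (u v : Utensors G) : Utensors G :=
  beta G (Rmul (beta_inv u) (beta_inv v)).

(* The bound m <= l is carried by the type of the first component. *)
Definition tri (l : nat) (k : 'I_l.+1) (t : int) : set ('I_l.+1 * int) :=
  [set p : 'I_l.+1 * int | exists j : nat,
     [/\ (j <= l - k)%N, (k + j <= p.1)%N & p.2 = t - j%:Z]].

Definition triangle (At : int -> finGroupType) (l : nat) (A : group_system At)
    (B : basis l A) (G : labelling B) (k : 'I_l.+1) (t : int) : Type :=
  forall p : tri k t, G (val p).1 (val p).2.

Definition nabla (At : int -> finGroupType) (l : nat) (A : group_system At)
    (B : basis l A) (G : labelling B) (k : 'I_l.+1) (t : int)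
    (u : Utensors G) : triangle G k t :=
  fun p => u (val p).1 (val p).2.
Arguments nabla {At l A B G} k t u _.

(* The sequence is indexed by an interval of integers, so that it may be finite,
   infinite in one direction, or bi-infinite. *)
Record paired_seq (l : nat) := PairedSeq {
  ps_dom : interval int;
  ps_k : {n : int | n \in ps_dom} -> 'I_l.+1;
  ps_t : {n : int | n \in ps_dom} -> int;
  ps_decr : forall i j, val i < val j -> ps_t j < ps_t i;
  ps_indep : forall i j, i != j ->
    ~ (tri (ps_k i) (ps_t i) `<=` tri (ps_k j) (ps_t j)) }.

Definition triangle_seq (At : int -> finGroupType) (l : nat)
    (A : group_system At) (B : basis l A) (G : labelling B)
    (p : paired_seq l) : Type :=
  forall i : {n : int | n \in ps_dom p}, triangle G (ps_k i) (ps_t i).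

Definition bnabla (At : int -> finGroupType) (l : nat) (A : group_system At)
    (B : basis l A) (G : labelling B) (p : paired_seq l) (u : Utensors G) :
    triangle_seq G p :=
  fun i => nabla (ps_k i) (ps_t i) u.
Arguments bnabla {At l A B G} p u _.

Definition bnabla_set (At : int -> finGroupType) (l : nat)
    (A : group_system At) (B : basis l A) (G : labelling B)
    (p : paired_seq l) : set (triangle_seq G p) :=
  range (fun u : Utensors G => bnabla p u).
Arguments bnabla_set {At l A B} G p _.

Definition bnabla_in (At : int -> finGroupType) (l : nat)
    (A : group_system At) (B : basis l A) (G : labelling B)
    (p : paired_seq l) (u : Utensors G) : bnabla_set G p :=
  exist _ (bnabla p u) (mem_set (imageT (fun u : Utensors G => bnabla p u) u)).
Arguments bnabla_in {At l A B G} p u.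

Definition is_group (T : Type) (op : T -> T -> T) : Prop :=
  exists (e : T) (inv : T -> T),
    [/\ associative op, left_id e op, right_id e op,
        left_inverse e inv op & right_inverse e inv op].

(* Main.v *)
Require Import Defs.
From mathcomp Require Import all_boot all_order all_algebra all_fingroup.
From mathcomp Require Import boolp classical_sets.
From mathcomp Require Import zify.

(* Let [N_k^t = X^{t+1} Y^{t+k-1}], a normal subgroup of [A].  Generators that
   start after [t] lie in [X^{t+1}] and those that end before [t + k] lie in
   [Y^{t+k-1}]; the others are exactly those indexed by the triangle [T_k^t].
   Hence [alpha r] is congruent modulo [N_k^t] to the finite ordered product of
   the generators in [T_k^t].  By downward induction on [k], starting from
   controllability ([N_{l+1}^t = A]), each class modulo [N_k^t] is represented
   by a unique choice of generators in [T_k^t], because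
   [(N_{k+1}^t /\ N_{k+1}^{t-1}) / N_k^t] is the granule at [(k, t)].  So
   two sequences of triangles coincide iff the corresponding elements of [A]
   agree modulo the intersection of the [N_k^t], and [oplus] is the
   multiplication of the quotient of [A] by this intersection. *)

Set Implicit Arguments.
Unset Strict Implicit.
Unset Printing Implicit Defensive.

Import Order.TTheory GRing.Theory Num.Theory.
Local Open Scope classical_set_scope.
Local Open Scope ring_scope.

(** * Ordered products over windows of start times *)

Section Windows.
Variables (gT : groupType) (h : int -> gT).

(** With [h i] the time-[s] component of the row of generators starting at [i], this and the next
    lemma pad a window with trivial factors at its late and early ends. Windows that depend on [s]
    thus become one common window. *)
Lemma prod_window_shift (t : int) (d n : nat) :
    (forall i, t < i -> h i = 1%g) ->
  (\prod_(0 <= j < d + n) h (t + d%:Z - j%:Z) = \prod_(0 <= j < n) h (t - j%:Z))%g.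
Proof.
move=> h1; elim: d => [|d IHd]; first by rewrite add0n addr0.
rewrite addSn big_nat_recl // h1 ?mul1g; last lia.
rewrite -IHd; apply: eq_bigr => j _; congr h; lia.
Qed.

Lemma prod_window_extend (t : int) (d n : nat) :
    (forall i, i <= t - n%:Z -> h i = 1%g) ->
  (\prod_(0 <= j < n + d) h (t - j%:Z) = \prod_(0 <= j < n) h (t - j%:Z))%g.
Proof.
move=> h1; elim: d => [|d IHd]; first by rewrite addn0.
rewrite addnS big_nat_recr //= IHd h1 ?mulg1 //; lia.
Qed.

End Windows.

(** The operation is computed on chosen preimages [rep]; the choice is immaterial because [A]
    normalizes [M]. The group laws then come from [gT] through [phi]. *)
Lemma quotient_group (gT : groupType) (A M : set gT) (U S : Type)
    (phi : U -> gT) (mul : U -> U -> U) (pi : U -> S) :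
    A 1%g -> (forall a, A a -> A a^-1%g) ->
    (forall u, A (phi u)) -> (forall a, A a -> exists u, phi u = a) ->
    (forall u v, phi (mul u v) = (phi u * phi v)%g) ->
    M 1%g -> (forall a b, M a -> M b -> M (a * b)%g) ->
    (forall a b, A b -> M a -> M (b * a * b^-1)%g) ->
    (forall x, exists u, pi u = x) ->
    (forall u v, pi u = pi v <-> M (phi u * (phi v)^-1)%g) ->
  exists oplus : S -> S -> S,
    (forall u v, oplus (pi u) (pi v) = pi (mul u v)) /\ is_group oplus.
Proof.
move=> A1 AV Aphi phi_onto phiM M1 MM MJ pi_onto piE.
have pi_eq u v : phi u = phi v -> pi u = pi v.
  by move=> e; apply/piE; rewrite e mulgV.
have /choice[rep repK] := pi_onto.
have oplusE u v : pi (mul (rep (pi u)) (rep (pi v))) = pi (mul u v).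
  have /piE Mu := repK (pi u); have /piE Mv := repK (pi v).
  (* With $a', b'$ the images of the representatives and $a, b$ those of [u] and [v]: $a'b'(ab)^{-1}
     = a'(b'b^{-1})a'^{-1} \cdot a'a^{-1}$. *)
  apply/piE; rewrite !phiM invgM.
  have := MM _ _ (MJ _ _ (Aphi (rep (pi u))) Mv) Mu.
  by rewrite !mulgA mulgVK.
have [e phie] := phi_onto _ A1.
have /choice[inv phiV] : forall u, exists v, phi v = (phi u)^-1%g.
  by move=> u; apply/phi_onto/AV/Aphi.
exists (fun x y => pi (mul (rep x) (rep y))); split=> //.
exists (pi e), (fun x => pi (inv (rep x))); split=> [x y z|x|x|x|x].
- have [u <-] := pi_onto x; have [v <-] := pi_onto y; have [w <-] := pi_onto z.
  by rewrite (oplusE v w) (oplusE u v) !oplusE; apply: pi_eq; rewrite !phiM mulgA.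
- have [u <-] := pi_onto x.
  by rewrite oplusE; apply: pi_eq; rewrite phiM phie mul1g.
- have [u <-] := pi_onto x.
  by rewrite oplusE; apply: pi_eq; rewrite phiM phie mulg1.
- have := oplusE (inv (rep x)) (rep x); rewrite (repK x) => ->.
  by apply: pi_eq; rewrite phiM phiV phie mulVg.
- have := oplusE (rep x) (inv (rep x)); rewrite (repK x) => ->.
  by apply: pi_eq; rewrite phiM phiV phie mulgV.
Qed.

(** * The normal subgroups $N_k^t$ *)

Section GroupSystem.
Variables (At : int -> finGroupType) (A : group_system At).
Implicit Types (a b c x y : seqs At) (t : int) (k : nat).

Lemma seqs_prodE (I : Type) (s : seq I) (P : pred I) (F : I -> seqs At) t :
  (\prod_(i <- s | P i) F i)%g t = (\prod_(i <- s | P i) F i t)%g.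
Proof. exact: (big_morph (fun a : seqs At => a t)). Qed.

Lemma gs_prod (I : Type) (s : seq I) (P : pred I) (F : I -> seqs At) :
  (forall i, gs_set A (F i)) -> gs_set A (\prod_(i <- s | P i) F i)%g.
Proof.
by move=> AF; apply: big_ind => // [|a b]; [exact: gs_one | exact: gs_mul].
Qed.

(* The normal subgroup [N_k^t]. *)
Definition XY k t : set (seqs At) :=
  prod_set (Xsub A (t + 1)) (Ysub A (t + k%:Z - 1)).

Lemma Xsub_conj t a x : gs_set A a -> Xsub A t x -> Xsub A t (a * x * a^-1)%g.
Proof.
move=> Aa [Ax x1]; split=> [|s st].
  by do 2?[apply: gs_mul] => //; apply: gs_inv.
by change (a s * x s * (a s)^-1 = 1)%g; rewrite x1 // mulg1 mulgV.
Qed.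

Lemma Ysub_conj t a x : gs_set A a -> Ysub A t x -> Ysub A t (a * x * a^-1)%g.
Proof.
move=> Aa [Ax x1]; split=> [|s st].
  by do 2?[apply: gs_mul] => //; apply: gs_inv.
by change (a s * x s * (a s)^-1 = 1)%g; rewrite x1 // mulg1 mulgV.
Qed.

Lemma Xsub_mul t x y : Xsub A t x -> Xsub A t y -> Xsub A t (x * y)%g.
Proof.
move=> [Ax x1] [Ay y1]; split=> [|s st]; first exact: gs_mul.
by change (x s * y s = 1)%g; rewrite x1 // y1 // mulg1.
Qed.

Lemma Ysub_mul t x y : Ysub A t x -> Ysub A t y -> Ysub A t (x * y)%g.
Proof.
move=> [Ax x1] [Ay y1]; split=> [|s st]; first exact: gs_mul.
by change (x s * y s = 1)%g; rewrite x1 // y1 // mulg1.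
Qed.

Lemma Xsub_inv t x : Xsub A t x -> Xsub A t x^-1%g.
Proof.
move=> [Ax x1]; split=> [|s st]; first exact: gs_inv.
by change ((x s)^-1 = 1)%g; rewrite x1 // invg1.
Qed.

Lemma Ysub_inv t x : Ysub A t x -> Ysub A t x^-1%g.
Proof.
move=> [Ax x1]; split=> [|s st]; first exact: gs_inv.
by change ((x s)^-1 = 1)%g; rewrite x1 // invg1.
Qed.

Lemma Xsub1 t : Xsub A t 1%g.
Proof. by split=> //; exact: gs_one. Qed.

Lemma Ysub1 t : Ysub A t 1%g.
Proof. by split=> //; exact: gs_one. Qed.

Lemma Xsub_le t t' x : t <= t' -> Xsub A t' x -> Xsub A t x.
Proof. by move=> tt' [Ax x1]; split=> // s st; apply: x1; lia. Qed.

Lemma Ysub_le t t' x : t <= t' -> Ysub A t x -> Ysub A t' x.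
Proof. by move=> tt' [Ax x1]; split=> // s st; apply: x1; lia. Qed.

Lemma Xsub_div t a b : gs_set A a -> gs_set A b ->
  (forall s, s < t -> a s = b s) -> Xsub A t (a * b^-1)%g.
Proof.
move=> Aa Ab ab; split=> [|s st]; first by apply: gs_mul => //; apply: gs_inv.
by change (a s * (b s)^-1 = 1)%g; rewrite ab // mulgV.
Qed.

Lemma Ysub_div t a b : gs_set A a -> gs_set A b ->
  (forall s, t < s -> a s = b s) -> Ysub A t (a * b^-1)%g.
Proof.
move=> Aa Ab ab; split=> [|s st]; first by apply: gs_mul => //; apply: gs_inv.
by change (a s * (b s)^-1 = 1)%g; rewrite ab // mulgV.
Qed.

Lemma X_XY k t x : Xsub A (t + 1) x -> XY k t x.
Proof. by move=> Xx; exists x => //; exists 1%g; [exact: Ysub1 | rewrite mulg1]. Qed.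

Lemma Y_XY k t y : Ysub A (t + k%:Z - 1) y -> XY k t y.
Proof.
by move=> Yy; exists 1%g; [exact: Xsub1 | exists y => //; rewrite mul1g].
Qed.

Lemma XY1 k t : XY k t 1%g.
Proof. exact/X_XY/Xsub1. Qed.

Lemma XY_mul k t a b : XY k t a -> XY k t b -> XY k t (a * b)%g.
Proof.
move=> [x Xx [y Yy <-]] [x' Xx' [y' Yy' <-]].
exists (x * (y * x' * y^-1))%g.
  by apply: Xsub_mul => //; apply: Xsub_conj => //; case: Yy.
exists (y * y')%g; first exact: Ysub_mul.
by rewrite !mulgA mulgVK.
Qed.

Lemma XY_conj k t a b : gs_set A b -> XY k t a -> XY k t (b * a * b^-1)%g.
Proof.
move=> Ab [x Xx [y Yy <-]].
exists (b * x * b^-1)%g; first exact: Xsub_conj.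
by exists (b * y * b^-1)%g; [exact: Ysub_conj | rewrite !mulgA mulgVK].
Qed.

Lemma XY_inv k t a : XY k t a -> XY k t a^-1%g.
Proof.
move=> [x Xx [y Yy <-]]; rewrite invgM.
by apply: XY_mul; [exact/Y_XY/Ysub_inv | exact/X_XY/Xsub_inv].
Qed.

(** Controllability splices [a] to the identity: [b] equals [a] through time [t] and is trivial
    after [t + l], so $a = (ab^{-1})b$ is the required factorization. *)
Lemma XY_controllable l t a : controllable l A -> gs_set A a -> XY l.+1 t a.
Proof.
move=> [_ /(_ (t + 1)) Actr] Aa.
have [b Ab [ba b1]] := Actr _ _ Aa (gs_one A).
exists (a * b^-1)%g; first by apply: Xsub_div => // s /ba.
exists b; last by rewrite mulgVK.
by split=> // s st; apply: b1; lia.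
Qed.

(** * Generators, granules and products over triangles *)

Section Basis.
Variables (l : nat) (B : basis l A).
Implicit Types r : Rtensors B.

(** If $g'^{-1}g = xy$ with $x \in X^{t+1}$ and $y \in Y^{t+k-1}$, then also $y \in X^t$, as [x],
    [g] and [g'] lie there. Hence [g] and [g'] are in the same coset of the granule. *)
Lemma gens_separated (k : 'I_l.+1) t (g g' : B k t) :
  XY k t (val g * (val g')^-1)%g -> g = g'.
Proof.
case: g g' => [g gB] [g' g'B] /= Ngg'; apply: val_inj => /=.
move/set_mem: gB => gB; move/set_mem: g'B => g'B.
have [Ag g1] := gens_supported gB; have [Ag' g'1] := gens_supported g'B.
have Xg : Xsub A t g by split=> // s st; apply: g1; lia.
have Xg' : Xsub A t g' by split=> // s st; apply: g'1; lia.
have Yg' : Ysub A (t + k%:Z) g' by split=> // s st; apply: g'1; lia.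
have /(XY_conj (gs_inv Ag')) := Ngg'.
rewrite invgK !mulgA mulgVK => -[x Xx [y Yy xyE]].
pose C := prod_set [set g'] (chain A t (t + k%:Z - 1)).
have [_ /(_ C)[]] := gens_transversal B k t.
  exists g' => //; exists 1%g; first exact: Xsub1.
  by exists g' => //; rewrite mul1g.
move=> g0 [_ g0_unique]; transitivity g0; [symmetry|]; apply: g0_unique.
- split=> //; exists g' => //; exists (g'^-1 * g)%g; last by rewrite mulKVg.
  exists x => //; exists y => //; split=> //.
  have -> : y = (x^-1 * (g'^-1 * g))%g by rewrite -xyE mulKg.
  apply: Xsub_mul; first by apply: Xsub_inv; apply: Xsub_le Xx; lia.
  by apply: Xsub_mul => //; exact: Xsub_inv.
- split=> //; exists g' => //; exists 1%g; last by rewrite mulg1.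
  exists 1%g; first exact: Xsub1.
  by exists 1%g; [split; [exact: Xsub1 | exact: Ysub1] | rewrite mulg1].
Qed.

(** From $c = xy = x'y'$, the element $z = yy'^{-1} = x^{-1}x'$ lies in $X^t \cap Y^{t+k}$. So $c =
    (xz)y'$ with $y' \in Y^{t+k-1}$, and the representative of the granule coset of $xz$ serves for
    [c]. *)
Lemma gens_cover (k : 'I_l.+1) t c :
  XY k.+1 t c -> XY k.+1 (t - 1) c -> exists g : B k t, XY k t (c * (val g)^-1)%g.
Proof.
move=> [x Xx [y Yy cE]] [x' Xx' [y' Yy' cE']].
pose z := (y * y'^-1)%g.
have zE : z = (x^-1 * x')%g.
  by apply: (mulgI x); rewrite mulKVg /z mulgA cE -cE' mulgK.
have Xz : Xsub A t z.
  rewrite zE; apply: Xsub_mul; last by apply: Xsub_le Xx'; lia.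
  by apply: Xsub_inv; apply: Xsub_le Xx; lia.
have Yz : Ysub A (t + k%:Z) z.
  apply: Ysub_mul; first by apply: Ysub_le Yy; lia.
  by apply: Ysub_inv; apply: Ysub_le Yy'; lia.
pose C := prod_set [set (x * z)%g] (chain A t (t + k%:Z - 1)).
have [_ /(_ C)[]] := gens_transversal B k t.
  by exists (x * z)%g => //; exists x => //; exists z.
move=> g [[gB [_ -> [_ [x2 Xx2 [z2 [Xz2 Yz2] <-]] gE]]] _].
exists (exist _ g (mem_set gB)) => /=.
have [Ag _] := gens_supported gB.
have -> : (c * g^-1 = g * (g^-1 * c) * g^-1)%g by rewrite mulKVg.
apply: XY_conj => //.
have -> : (g^-1 * c = (x2 * z2)^-1 * y')%g.
  rewrite -gE invgM -mulgA; congr (_ * _)%g.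
  by rewrite -cE /z invgM invgM invgK !mulgA !mulgVK.
apply: XY_mul; last by apply: Y_XY; apply: Ysub_le Yy'; lia.
by apply: XY_inv; apply: XY_mul; [exact: X_XY | exact: Y_XY].
Qed.

(* The generators of [r], extended by [1] to lengths [m > l]. *)
Definition gen r (m : nat) t : seqs At :=
  if insub m is Some k then val (r k t) else 1%g.

Lemma gen_ord r (k : 'I_l.+1) t : gen r k t = val (r k t).
Proof. by rewrite /gen valK. Qed.

Lemma gen_gs r m t : gs_set A (gen r m t).
Proof.
rewrite /gen; case: insubP => [k _ _|_]; last exact: gs_one.
by case: (r k t) => g /= /set_mem /gens_supported[].
Qed.

Lemma gen_out r m t s : ~~ (t <= s <= t + m%:Z) -> gen r m t s = 1%g.
Proof.
rewrite /gen; case: insubP => [k _ <-|//].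
by case: (r k t) => g /= /set_mem /gens_supported[_]; apply.
Qed.

(* The product of the generators in [T_k^t], in the order used by [alpha]. *)
Definition tri_prod r k t : seqs At :=
  (\prod_(0 <= j < l.+1) \prod_(k + j <= m < l.+1) gen r m (t - j%:Z))%g.

Lemma tri_prod_gs r k t : gs_set A (tri_prod r k t).
Proof. by apply: gs_prod => j; apply: gs_prod => m; exact: gen_gs. Qed.

Lemma tri_prodE r k t s : tri_prod r k t s =
  (\prod_(0 <= j < l.+1) \prod_(k + j <= m < l.+1) gen r m (t - j%:Z) s)%g.
Proof. by rewrite /tri_prod seqs_prodE; apply: eq_bigr => j _; rewrite seqs_prodE. Qed.

Definition row_prod r k t : seqs At := (\prod_(k <= m < l.+1) gen r m t)%g.

Lemma row_prod_gs r k t : gs_set A (row_prod r k t).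
Proof. by apply: gs_prod => m; exact: gen_gs. Qed.

Lemma row_prod_out r k t s : ~~ (t <= s <= t + l%:Z) -> row_prod r k t s = 1%g.
Proof.
move=> ts; rewrite /row_prod seqs_prodE big_nat_cond big1 // => m mP.
by apply: gen_out; lia.
Qed.

(* Only the generators of length at least [s - t] are nontrivial at time [s]. *)
Lemma row_prod_min r k k' t s : t + k%:Z <= s -> (k' <= k)%N ->
  row_prod r k' t s = row_prod r k t s.
Proof.
move=> ts k'k; rewrite /row_prod !seqs_prodE.
rewrite !big_geq_mkord [LHS]big_mkcond [RHS]big_mkcond.
apply: eq_bigr => m _ /=.
case: (leqP k m) => [km|mk]; first by rewrite (leq_trans k'k km).
by case: ifP => // _; apply: gen_out; lia.
Qed.

Lemma tri_prod_rows r k t :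
  tri_prod r k t = (\prod_(0 <= j < l.+1) row_prod r (k + j) (t - j%:Z))%g.
Proof. by []. Qed.

Lemma tri_prod_recl r k t :
  tri_prod r k t = (row_prod r k t * tri_prod r k.+1 (t - 1))%g.
Proof.
rewrite !tri_prod_rows big_nat_recl // addn0 subr0; congr (_ * _)%g.
(* Both windows have length [l.+1]; the last row of the smaller triangle is empty. *)
have row1 s : row_prod r (k.+1 + l) s = 1%g by apply: big_geq; lia.
rewrite big_nat_recr //= row1 mulg1.
by apply: eq_bigr => j _; congr (row_prod r _ _); lia.
Qed.

(* [tri_prod r k t] without its leftmost factor, the one indexed by [(k, t)]. *)
Definition tri_rest r k t : seqs At :=
  (row_prod r k.+1 t * tri_prod r k.+1 (t - 1))%g.

Lemma tri_prod_split r (k : 'I_l.+1) t :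
  tri_prod r k t = (val (r k t) * tri_rest r k t)%g.
Proof.
by rewrite tri_prod_recl /tri_rest mulgA -gen_ord /row_prod big_ltn.
Qed.

(** The generators dropped from $T_k^t$ are those at $(k+j, t-j)$, all of which end at time
    $t+k$. *)
Lemma tri_prod_shorter r k t s : t + k%:Z < s ->
  tri_prod r k t s = tri_prod r k.+1 t s.
Proof.
move=> ts; rewrite !tri_prod_rows !seqs_prodE; apply: eq_bigr => j _.
by apply: row_prod_min; lia.
Qed.

Lemma tri_prod_earlier r k t s : s < t ->
  tri_prod r k t s = tri_prod r k.+1 (t - 1) s.
Proof.
move=> st; rewrite tri_prod_recl.
change (row_prod r k t s * tri_prod r k.+1 (t - 1) s = tri_prod r k.+1 (t - 1) s)%g.
by rewrite row_prod_out ?mul1g //; lia.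
Qed.

Lemma tri_rest_gs r k t : gs_set A (tri_rest r k t).
Proof. by apply: gs_mul; [exact: row_prod_gs | exact: tri_prod_gs]. Qed.

Lemma eq_tri_prod r r' k t :
    (forall (m : 'I_l.+1) (j : nat), (j <= l)%N -> (k + j <= m)%N ->
      r m (t - j%:Z) = r' m (t - j%:Z)) ->
  tri_prod r k t = tri_prod r' k t.
Proof.
move=> rr'; rewrite /tri_prod; apply: eq_big_nat => j jl.
apply: eq_big_nat => m /andP[km ml].
by rewrite -[m]/(nat_of_ord (Ordinal ml)) !gen_ord rr' //; lia.
Qed.

Lemma eq_tri_rest r r' k t :
    (forall m : 'I_l.+1, (k < m)%N -> r m t = r' m t) ->
    (forall (m : 'I_l.+1) (j : nat), (j <= l)%N -> (k.+1 + j <= m)%N ->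
      r m (t - 1 - j%:Z) = r' m (t - 1 - j%:Z)) ->
  tri_rest r k t = tri_rest r' k t.
Proof.
move=> rr' rr'1; congr (_ * _)%g; last exact: eq_tri_prod.
apply: eq_big_nat => m /andP[km ml].
by rewrite -[m]/(nat_of_ord (Ordinal ml)) !gen_ord rr'.
Qed.

(* The triangle [T_k^t] is [T_{k+1}^t] and [T_{k+1}^{t-1}] together with
   the corner [(k, t)]. *)
Lemma tri_prod_inj r r' k t :
    XY k t (tri_prod r k t * (tri_prod r' k t)^-1)%g ->
  forall (m : 'I_l.+1) (j : nat), (k + j <= m)%N ->
    r m (t - j%:Z) = r' m (t - j%:Z).
Proof.
have [n] := ubnP (l.+1 - k); elim: n k t => [//|n IHn] k t ltn Nrr' m j kjm.
have kl : (k < l.+1)%N by have := ltn_ord m; lia.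
(* Used with [P], [Q] the products over $T_k^t$ and [P'], [Q'] those over a smaller triangle. The
   outer factors lie in $Y^{t+k}$ or $X^t$, the middle one in $N_k^t$. *)
have divE P Q (P' Q' : seqs At) : (P' * Q'^-1)%g =
    ((P' * P^-1) * ((P * Q^-1) * (Q * Q'^-1)))%g.
  by rewrite !mulgA !mulgVK.
have Nle k' t' c : t + 1 = t' + 1 \/ t = t' + 1 -> t + k%:Z <= t' + k'%:Z ->
    XY k t c -> XY k' t' c.
  move=> tt' kk' [x Xx [y Yy <-]]; exists x; first by apply: Xsub_le Xx; lia.
  by exists y => //; apply: Ysub_le Yy; lia.
have shorter : forall (m : 'I_l.+1) (j : nat), (k.+1 + j <= m)%N ->
    r m (t - j%:Z) = r' m (t - j%:Z).
  apply: IHn; first lia.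
  rewrite (divE (tri_prod r k t) (tri_prod r' k t)).
  apply: XY_mul; [|apply: XY_mul; first by apply: Nle Nrr'; lia].
    apply: Y_XY; apply: Ysub_div => [||s st]; [exact: tri_prod_gs..|].
    by rewrite (@tri_prod_shorter _ k) //; lia.
  apply: Y_XY; apply: Ysub_div => [||s st]; [exact: tri_prod_gs..|].
  by rewrite (@tri_prod_shorter _ k) //; lia.
have earlier : forall (m : 'I_l.+1) (j : nat), (k.+1 + j <= m)%N ->
    r m (t - 1 - j%:Z) = r' m (t - 1 - j%:Z).
  apply: IHn; first lia.
  rewrite (divE (tri_prod r k t) (tri_prod r' k t)).
  apply: XY_mul; [|apply: XY_mul; first by apply: Nle Nrr'; lia].
    apply: X_XY; apply: Xsub_div => [||s st]; [exact: tri_prod_gs..|].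
    by rewrite (@tri_prod_earlier _ k) //; lia.
  apply: X_XY; apply: Xsub_div => [||s st]; [exact: tri_prod_gs..|].
  by rewrite (@tri_prod_earlier _ k) //; lia.
case: j kjm => [|j] kjm; last first.
  have -> : t - j.+1%:Z = t - 1 - j%:Z by lia.
  by apply: earlier; lia.
rewrite subr0; have [km|mk] := ltnP k m.
  by rewrite -(subr0 t); apply: (shorter m 0%N); lia.
have {mk kjm} mE : k = m by lia.
(* Only the corner remains: the rests of the two products agree by [shorter] and [earlier], and they
   cancel. *)
subst k; apply: gens_separated.
move: Nrr'; rewrite !tri_prod_split (@eq_tri_rest r' r).
- by rewrite invgM mulgA mulgK.
- by move=> m' mm'; rewrite -(subr0 t) (shorter m' 0%N) //; lia.
- by move=> m' j _ mm'; rewrite earlier.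
Qed.

(** * The map [alpha] modulo $N_k^t$, and its surjectivity *)

Lemma alphaE r s : alpha r s = tri_prod r 0 s s.
Proof.
rewrite tri_prodE big_mkord; apply: eq_bigr => j _.
rewrite add0n big_geq_mkord; apply: eq_bigr => m _.
by rewrite gen_ord.
Qed.

Lemma alpha_rows r s :
  alpha r s = (\prod_(0 <= j < l.+1) row_prod r 0 (s - j%:Z) s)%g.
Proof.
rewrite alphaE tri_prod_rows seqs_prodE; apply: eq_bigr => j _.
by rewrite -(@row_prod_min _ _ 0) //; lia.
Qed.

Lemma alpha_gs r : complete A -> gs_set A (alpha r).
Proof.
move=> Acompl; apply: Acompl => m n.
(* Rows starting from [n] down to [m - l] are the only ones that can act during $[m,n]$, so a finite
   product suffices for completeness. *)
exists (\prod_(0 <= j < (`|n - m|%N + l.+1)%N) row_prod r 0 (n - j%:Z))%g.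
  by apply: gs_prod => j; exact: row_prod_gs.
move=> s smn; rewrite seqs_prodE alpha_rows.
rewrite -(@prod_window_extend _ (fun i => row_prod r 0 i s) s (`|s - m|%N) l.+1).
  rewrite -(@prod_window_shift _ (fun i => row_prod r 0 i s) s `|n - s|%N); last first.
    by move=> i si; apply: row_prod_out; lia.
  have -> : s + `|n - s|%N%:Z = n by lia.
  by congr (\big[_/_]_(i <- index_iota _ _) _); lia.
by move=> i si; apply: row_prod_out; lia.
Qed.

Definition past r t : Rtensors B := fun m s => if s <= t then r m s else Rone B m s.

Lemma row_prod_past r k t s :
  row_prod (past r t) k s = if s <= t then row_prod r k s else 1%g.
Proof.
rewrite /row_prod /gen /past; case: ifP => // _.
by apply: big1 => m _; case: insubP.
Qed.

(* The generators starting at or before [t] and alive at a time [s >= t + k]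
   all lie in the triangle [T_k^t]. *)
Lemma alpha_past r k t s : t + k%:Z <= s -> alpha (past r t) s = tri_prod r k t s.
Proof.
move=> ts; rewrite alpha_rows tri_prod_rows seqs_prodE.
rewrite -(@prod_window_extend _ (fun i => row_prod (past r t) 0 i s) s (`|s - t|%N) l.+1).
  have sE : s = t + `|s - t|%N%:Z by lia.
  rewrite addnC.
  have /(@prod_window_shift _ _ t `|s - t|%N l.+1) :
      forall i, t < i -> row_prod (past r t) 0 i s = 1%g.
    by move=> i ti; rewrite row_prod_past; case: ifP => //; lia.
  rewrite -sE => ->; apply: eq_bigr => j _.
  rewrite row_prod_past ifT; last lia.
  by apply: row_prod_min => //; lia.
by move=> i si; apply: row_prod_out; lia.
Qed.

(** The truncation [past r t] is the intermediate point: its image agrees with [alpha r] through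
    time [t], and with the triangle product from time [t + k] on. *)
Lemma alpha_tri_prod r k t : complete A ->
  XY k t (alpha r * (tri_prod r k t)^-1)%g.
Proof.
move=> Acompl; exists (alpha r * (alpha (past r t))^-1)%g.
  apply: Xsub_div => [||s st]; [exact: alpha_gs..|].
  rewrite !alpha_rows; apply: eq_bigr => j _.
  by rewrite row_prod_past ifT //; lia.
exists (alpha (past r t) * (tri_prod r k t)^-1)%g; last by rewrite mulgA mulgVK.
apply: Ysub_div => [||s st]; [exact: alpha_gs | exact: tri_prod_gs|].
by apply: alpha_past; lia.
Qed.

Lemma alpha_agree r r' k t : complete A ->
  XY k t (alpha r * (alpha r')^-1)%g <->
  (forall (m : 'I_l.+1) (j : nat), (k + j <= m)%N ->
    r m (t - j%:Z) = r' m (t - j%:Z)).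
Proof.
move=> Acompl.
have Nr := alpha_tri_prod r k t Acompl.
have Nr' := alpha_tri_prod r' k t Acompl.
split=> [Nrr'|rr'].
  apply: tri_prod_inj.
  have := XY_mul (XY_inv Nr) (XY_mul Nrr' Nr').
  by rewrite invgM invgK !mulgA !mulgVK.
have PE : tri_prod r k t = tri_prod r' k t.
  by apply: eq_tri_prod => m j _ /rr'.
have := XY_mul Nr (XY_inv Nr').
by rewrite PE invgM invgK !mulgA !mulgVK.
Qed.

(** Generators are chosen from the longest down. A single [r] must serve all [t], since the choice
    of the corner $(k,t)$ uses the previous stage at both [t] and [t - 1]. *)
Lemma tri_prod_onto k a : controllable l A -> gs_set A a -> (k <= l.+1)%N ->
  exists r, forall t, XY k t (a * (tri_prod r k t)^-1)%g.
Proof.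
move=> Actr Aa; have [n] := ubnP (l.+1 - k); elim: n k => [//|n IHn] k ltn kl.
have [->|k_neq] := eqVneq k l.+1.
  exists (Rone B) => t; apply: XY_controllable => //.
  by apply: gs_mul => //; apply/gs_inv/tri_prod_gs.
have kl' : (k < l.+1)%N by lia.
have [||r Nr] := IHn k.+1; [lia..|].
pose k0 := Ordinal kl'.
have corner t : exists g : B k0 t,
    XY k t (a * (tri_rest r k t)^-1 * (val g)^-1)%g.
  have aE P : (a * (tri_rest r k t)^-1 = a * P^-1 * (P * (tri_rest r k t)^-1))%g.
    by rewrite mulgA mulgVK.
  have restE s : (tri_rest r k t s =
      (val (r k0 t) s)^-1 * tri_prod r k t s)%g.
    rewrite (tri_prod_split r k0).
    by change (tri_rest r k t s =
      (val (r k0 t) s)^-1 * (val (r k0 t) s * tri_rest r k t s))%g; rewrite mulKg.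
  have gen1 s : ~~ (t <= s <= t + k%:Z) -> val (r k0 t) s = 1%g.
    by move=> ts; rewrite -gen_ord gen_out.
  apply: (@gens_cover k0).
    rewrite (aE (tri_prod r k.+1 t)); apply: XY_mul => //.
    apply: Y_XY; apply: Ysub_div => [||s /= st]; [exact: tri_prod_gs | exact: tri_rest_gs|].
    by rewrite restE gen1 ?invg1 ?mul1g ?(@tri_prod_shorter _ k) //; lia.
  rewrite (aE (tri_prod r k.+1 (t - 1))); apply: XY_mul => //.
  apply: X_XY; apply: Xsub_div => [||s /= st]; [exact: tri_prod_gs | exact: tri_rest_gs|].
  by rewrite restE gen1 ?invg1 ?mul1g ?(@tri_prod_earlier _ k) //; lia.
have step (m : 'I_l.+1) t : exists g : B m t,
    (m <> k0 -> g = r m t) /\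
    (m = k0 -> XY k t (a * (tri_rest r k t)^-1 * (val g)^-1)%g).
  have [->|mk] := eqVneq m k0; first by have [g] := corner t; exists g.
  by exists (r m t); split=> // mE; rewrite mE eqxx in mk.
(* Only generators of length index [k] change, so every [tri_rest r k t] is preserved. *)
pose r' : Rtensors B := fun m t => projT1 (cid (step m t)).
have r'E m t : m <> k0 -> r' m t = r m t.
  by rewrite /r'; case: cid => /= g [].
exists r' => t.
rewrite (tri_prod_split r' k0) (@eq_tri_rest r' r).
- rewrite invgM mulgA /r'; case: cid => /= g [_]; exact.
- by move=> m km; apply: r'E => mE; rewrite mE /= ltnn in km.
- by move=> m j _ km; apply: r'E => mE; rewrite mE /= in km; lia.
Qed.

Lemma alpha_onto a : controllable l A -> gs_set A a -> exists r, alpha r = a.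
Proof.
move=> Actr Aa; have [r Nr] := tri_prod_onto Actr Aa (leq0n _).
exists r; apply: functional_extensionality_dep => t; rewrite alphaE.
(* An element of $N_0^t = X^{t+1}Y^{t-1}$ is trivial at time [t]. *)
have [x [_ x1] [y [_ y1] xyE]] := Nr t.
have /(congr1 (fun c : seqs At => c t)) := xyE.
change ((x t * y t = a t * (tri_prod r 0 t t)^-1)%g -> tri_prod r 0 t t = a t).
rewrite x1 ?y1; [|lia..].
by rewrite mulg1 => /esym /mulg1_eq /esym /(congr1 invg); rewrite !invgK.
Qed.

Lemma alpha_invK a : controllable l A -> gs_set A a -> alpha (alpha_inv B a) = a.
Proof.
move=> Actr Aa; have [r ra] := alpha_onto Actr Aa.
exact: (@xgetPex _ (Rone B) [set r | alpha r = a] (ex_intro _ r ra)).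
Qed.

End Basis.

End GroupSystem.

(** The bound $j \le l-k$ in [tri] follows from $k+j \le m \le l$, which gives the form of agreement
    used in [alpha_agree]. *)
Lemma bnabla_eqP (At : int -> finGroupType) (A : group_system At) (l : nat)
    (B : basis l A) (G : labelling B) (p : paired_seq l) (u v : Utensors G) :
    bnabla_in p u = bnabla_in p v <->
  (forall i (m : 'I_l.+1) (j : nat), (ps_k (p := p) i + j <= m)%N ->
    u m (ps_t i - j%:Z) = v m (ps_t i - j%:Z)).
Proof.
split=> [/(congr1 val) /= uv i m j kjm|uv].
  have Tq : tri (ps_k i) (ps_t i) (m, ps_t i - j%:Z).
    by exists j; split=> //=; have := ltn_ord m; lia.
  have /(congr1 (fun f : triangle_seq G p => f i (SigSub (mem_set Tq)))) := uv.
  exact.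
apply: val_inj; apply: functional_extensionality_dep => i.
apply: functional_extensionality_dep => -[[m s] Tq].
have [j [_ /= kjm sE]] := set_mem Tq; rewrite /bnabla /nabla /=.
by rewrite sE; exact: uv.
Qed.

Theorem theorem50 (At : int -> finGroupType) (A : group_system At) (l : nat)
    (A_controllable : controllable l A) (A_complete : complete A)
    (B : basis l A) (G : labelling B) (p : paired_seq l) :
  exists oplus : bnabla_set G p -> bnabla_set G p -> bnabla_set G p,
    (forall u v : Utensors G,
       oplus (bnabla_in p u) (bnabla_in p v) = bnabla_in p (Umul u v)) /\
    is_group oplus.
Proof.
have betaK : cancel (@beta _ _ _ _ G) (@beta_inv _ _ _ _ G).
  move=> r; apply: functional_extensionality_dep => k.
  by apply: functional_extensionality_dep => t; exact: labK.
have beta_invK : cancel (@beta_inv _ _ _ _ G) (@beta _ _ _ _ G).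
  move=> u; apply: functional_extensionality_dep => k.
  by apply: functional_extensionality_dep => t; exact: unlabK.
(* The kernel is the intersection of the $N_k^t$ along the paired sequence. *)
apply: (@quotient_group _ (gs_set A)
  [set c | forall i, XY A (ps_k (p := p) i) (ps_t i) c] _ _
  (fun u => alpha (beta_inv u)) (@Umul _ _ _ _ G)) => /=.
- exact: gs_one.
- exact: gs_inv.
- by move=> u; exact: alpha_gs.
- move=> a /(alpha_onto B A_controllable)[r <-].
  by exists (beta G r); rewrite betaK.
- move=> u v; rewrite /Umul betaK alpha_invK //.
  by apply: gs_mul; exact: alpha_gs.
- by move=> i; exact: XY1.
- by move=> a b Na Nb i; exact: XY_mul.
- by move=> a b Ab Na i; exact: XY_conj.
- by move=> [x xS]; have [u _ ux] := set_mem xS; exists u; exact: val_inj.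
- move=> u v; rewrite bnabla_eqP; split=> [uv i|uv i m j kjm].
    by apply/alpha_agree => // m j kjm; rewrite /beta_inv uv.
  have [/(_ (uv i) m j kjm) uv_mj _] :=
    alpha_agree (beta_inv u) (beta_inv v) (ps_k i) (ps_t i) A_complete.
  by rewrite -(beta_invK u) -(beta_invK v) /beta uv_mj.
Qed.
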